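(* Let $\mathfrak E$ be an EOS satisfying the standing assumptions below and let $\iota,\tau$ be configurations of $\mathfrak E$. If $\tau$ is $(\le_f,\omega)$-coverable from $\iota$ in $\mathfrak E$, then $\tau$ is $\le_f$-coverable from $\iota$ in $\mathfrak E^{cons}$.
   Context: EOS: A PN is $(P,T,F)$ with $F:(P\times T)\cup(T\times P)\to\mathbb N$, ${\tt pre}_N(t)(p)=F(p,t)$, ${\tt post}_N(t)(p)=F(t,p)$; $\blacksquare=(\emptyset,\emptyset,\emptyset)$ with unique marking $\varepsilon$. An EOS is $(\hat N,\mathcal N,d,\Theta)$: system PN $\hat N=(\hat P,\hat T,\hat F)$ containing idle transitions $id_p$ ($p\in\hat P$) consuming and producing one token on $p$ only; finite set $\mathcal N\ni\blacksquare$ of object PNs, all nets pairwise disjoint; typing $d:\hat P\to\mathcal N$; finite event set $\Theta$ of pairs $(\hat\tau,\theta)$, $\hat\tau\in\hat T$, $\theta(N)$ a finite multiset of transitions of $N$, with $\theta(d(p))\ne\emptyset$ if $\hat\tau=id_p$. Configurations: finite multisets of nested tokens $(\hat p,m)$, $m$ a marking of $d(\hat p)$. With $\Pi^1(\sum_i(\hat p_i,m_i))=\sum_i\hat p_i$, $\Pi^2_N(\sum_i(\hat p_i,m_i))=\sum_{d(\hat p_i)=N}m_i$: event $(\hat\tau,\theta)$ fires on $\mu$ with mode $(\lambda,\rho)$ iff $\lambda\sqsubseteq\mu$, $\Pi^1(\lambda)={\tt pre}_{\hat N}(\hat\tau)$, $\Pi^1(\rho)={\tt post}_{\hat N}(\hat\tau)$,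 and for all $N$: $\Pi^2_N(\lambda)\ge{\tt pre}_N(\theta(N))$, $\Pi^2_N(\rho)=\Pi^2_N(\lambda)-{\tt pre}_N(\theta(N))+{\tt post}_N(\theta(N))$; result $\mu-\lambda+\rho$. $\mu\le_f\mu'$ iff $\mu'$ arises from $\mu$ by adding tokens inside existing nested tokens and/or adding nested tokens. An event is system autonomous if $\theta(N)=\emptyset$ for all $N$. $\tau$ is $\le_f$-coverable from $\iota$ if some configuration reachable from $\iota$ by event firings is $\ge_f\tau$. A $(\le_f,\omega)$-run is a finite sequence of configurations in which each consecutive pair is a firing step $C_i\to^eC_{i+1}$ or a lossy step $C_{i+1}\le_f C_i$; $\tau$ is $(\le_f,\omega)$-coverable from $\iota$ if such a run leads from $\iota$ to some configuration $\ge_f\tau$. $t\in\hat T$ destroys type $N$ if $\hat F(p,t)\ne0$ for some $p$ with $d(p)=N$ and $\hat F(t,q)=0$ for all $q$ with $d(q)=N$; $\mathit{destroy}(t)$ is the set of such $N$. Standing assumptions on $\mathfrak E$: every $t\in\hat T$ occurs in exactly one event of $\Theta$, and if $\mathit{destroy}(t)\ne\emptyset$ that event is system autonomous. Conservative closure: $\mathfrak E^{cons}=(\hat N^{cons},\mathcal N,d^{cons},\Theta)$, $\hat N^{cons}=(\hat P\cup\{\mathit{trash}_N:N\in\mathcal N\},\hat T,\hat F^{cons})$ with new places $\mathit{trash}_N$, $\hat F^{cons}(p,t)=\hat F(p,t)$ (zero on trash places), $\hat F^{cons}(t,p)=\hat F(t,p)$ for $p\in\hat P$, $\hat F^{cons}(t,\mathit{trash}_N)=1$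 iff $N\in\mathit{destroy}(t)$ (else $0$), $d^{cons}$ extends $d$ by $d^{cons}(\mathit{trash}_N)=N$. Configurations of $\mathfrak E$ are configurations of $\mathfrak E^{cons}$. *)

(* Defs.v *)
From Stdlib Require Export Relation_Operators.
From HB Require Export structures.
From mathcomp Require Export all_boot.
From mathcomp Require Export finmap multiset.

Set Implicit Arguments.
Unset Strict Implicit.
Unset Printing Implicit Defensive.

Record petri_net := PetriNet {
  place : finType;
  trans : finType;
  pre_arc : place -> trans -> nat;  (* F (p, t) *)
  post_arc : trans -> place -> nat  (* F (t, p) *)
}.

Notation marking N := {ffun place N -> nat}.
Notation trans_multiset N := {ffun trans N -> nat}.

Definition pre_multi (N : petri_net) (th : trans_multiset N) (q : place N) :=
  \sum_(t : trans N) th t * pre_arc q t.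
Definition post_multi (N : petri_net) (th : trans_multiset N) (q : place N) :=
  \sum_(t : trans N) th t * post_arc t q.

Definition event_type (sys : petri_net) (objs : finType)
    (obj : objs -> petri_net) : choiceType :=
  (trans sys * {dffun forall k : objs, trans_multiset (obj k)})%type.

(* The tuple (system net, object nets, typing, events) without the conditions
   on the empty net and on idle transitions: the conservative closure adds
   places but no idle transitions for them, so it is only of this kind.
   The set of object nets is given as a finite family [obj]; since the nets
   have separate types of places and transitions, they are disjoint. *)
Record eos_structure := EosStructure {
  sys : petri_net;
  objs : finType;
  obj : objs -> petri_net;
  typ : place sys -> objs;
  events : {fset event_type sys obj}
}.

Definition event (E : eos_structure) := event_type (sys E) (@obj E).

Record eos := Eos {
  eos_base :> eos_structure;
  (* The empty net; a set of nets contains it once, hence [empty_net_unique]. *)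
  empty_net : objs eos_base;
  empty_net_place : #|place (obj empty_net)| = 0;
  empty_net_trans : #|trans (obj empty_net)| = 0;
  empty_net_unique : forall k : objs eos_base,
    #|place (obj k)| = 0 -> #|trans (obj k)| = 0 -> k = empty_net;
  idle : place (sys eos_base) -> trans (sys eos_base);
  idle_pre : forall p p' : place (sys eos_base),
    pre_arc p' (idle p) = (p' == p);
  idle_post : forall p p' : place (sys eos_base),
    post_arc (idle p) p' = (p' == p);
  idle_event : forall (e : event eos_base) (p : place (sys eos_base)),
    e \in events eos_base -> e.1 = idle p ->
    exists t : trans (obj (typ p)), e.2 (typ p) t != 0
}.

Definition token (E : eos_structure) : choiceType :=
  {p : place (sys E) & marking (obj (typ p))}.

Notation config E := {mset (token E)}%mset.

Section Semantics.

Variable E : eos_structure.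
Implicit Types (mu lam rho : config E) (x y : token E).

(* The marking carried by [x] if [x] has type [k], and the empty marking of the
   net [k] otherwise. *)
Definition inner (k : objs E) x : marking (obj k) :=
  match typ (tag x) =P k with
  | ReflectT e => ecast l (marking (obj l)) e (tagged x)
  | ReflectF _ => [ffun=> 0]
  end.

Definition Pi1 mu (p : place (sys E)) : nat :=
  \sum_(x <- mu) (tag x == p).

Definition Pi2 (k : objs E) mu (q : place (obj k)) : nat :=
  \sum_(x <- mu | typ (tag x) == k) inner k x q.

Definition enabled_mode (e : event E) mu lam rho : Prop :=
  [/\ (lam `<=` mu)%mset,
      (forall p, Pi1 lam p = pre_arc p e.1),
      (forall p, Pi1 rho p = post_arc e.1 p),
      (forall k (q : place (obj k)), pre_multi (e.2 k) q <= Pi2 lam q)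
    & (forall k (q : place (obj k)),
         Pi2 rho q = Pi2 lam q - pre_multi (e.2 k) q
                       + post_multi (e.2 k) q)].

Definition fires (e : event E) mu mu' : Prop :=
  exists lam rho : config E,
    enabled_mode e mu lam rho /\ mu' = (mu `\` lam `+` rho)%mset.

Definition fire_step mu mu' : Prop :=
  exists2 e : event E, e \in events E & fires e mu mu'.

Definition token_le x y : bool :=
  (tag x == tag y) && [forall q, tagged x q <= tagged_as x y q].

Definition config_le mu mu' : Prop :=
  exists (s s' : seq (token E)) (nu : config E),
    [/\ mu = seq_mset s, mu' = (seq_mset s' `+` nu)%mset & all2 token_le s s'].

Definition coverable iota tau : Prop :=
  exists2 mu, clos_refl_trans_1n (config E) fire_step iota mu & config_le tau mu.

Definition lossy_run_step mu mu' : Prop :=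
  fire_step mu mu' \/ config_le mu' mu.

Definition lossy_coverable iota tau : Prop :=
  exists2 mu, clos_refl_trans_1n (config E) lossy_run_step iota mu
            & config_le tau mu.

Definition destroy (t : trans (sys E)) : {set objs E} :=
  [set k | [exists p : place (sys E), (typ p == k) && (pre_arc p t != 0)] &&
           [forall q : place (sys E), (typ q == k) ==> (post_arc t q == 0)]].

Definition system_autonomous (e : event E) : Prop :=
  forall (k : objs E) (t : trans (obj k)), e.2 k t = 0.

Definition standing_assumptions : Prop :=
  (forall t : trans (sys E), exists! e : event E, e \in events E /\ e.1 = t) /\
  (forall e : event E, e \in events E -> destroy e.1 != set0 ->
     system_autonomous e).

(* [inl p] is an original place and [inr k] is the trash place of [k]. *)
Definition cons_net : petri_net := {|
  place := (place (sys E) + objs E)%type;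
  trans := trans (sys E);
  pre_arc := fun p t => match p with inl p => pre_arc p t | inr _ => 0 end;
  post_arc := fun t p =>
    match p with
    | inl p => post_arc t p
    | inr k => k \in destroy t : nat
    end
|}.

Definition cons_typ (p : place cons_net) : objs E :=
  match p with inl p => typ p | inr k => k end.

Definition cons_closure : eos_structure := {|
  sys := cons_net;
  objs := objs E;
  obj := @obj E;
  typ := cons_typ;
  events := events E : {fset event_type cons_net (@obj E)}
|}.

End Semantics.

Definition cons_token (E : eos_structure) (x : token E) :
    token (cons_closure E) :=
  Tagged (fun p : place (sys (cons_closure E)) => marking (obj (typ p)))
    (tagged x : marking (obj (@typ (cons_closure E) (inl (tag x))))).

Definition cons_config (E : eos_structure) (mu : config E) :
    config (cons_closure E) :=
  seq_mset [seq cons_token x | x <- mu].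

(* Main.v *)
Require Import Defs.

(** Lossy steps are postponed: the closure keeps a configuration that dominates
    the one of the lossy run, and it fires the same events.  When an event
    consumes dominating tokens, the excess inner tokens of each type [k] must
    reappear in the produced nested tokens.  They are added to any one produced
    token of type [k]; if the event produces none although it consumes one,
    then it destroys [k], and they go to the trash place of [k]. *)

(** * Pointwise related sequences: splitting and reordering *)

Section All2.

Context {S T : eqType} (r : S -> T -> bool).
Implicit Types (s : seq S) (t : seq T).

Lemma all2_cat {s1 s2 t1 t2} :
  all2 r s1 t1 -> all2 r s2 t2 -> all2 r (s1 ++ s2) (t1 ++ t2).
Proof.
elim: s1 t1 => [|x s1 IH] [|y t1] //= /andP[-> H1] H2.
exact: IH.
Qed.

Lemma all2_cat_inv {s1 s2 t} : all2 r (s1 ++ s2) t ->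
  exists t1 t2, [/\ t = t1 ++ t2, all2 r s1 t1 & all2 r s2 t2].
Proof.
elim: s1 t => [|x s1 IH] t /=; first by exists [::], t.
case: t => [|y t] // /andP[rxy /IH[t1 [t2 [-> H1 H2]]]].
by exists (y :: t1), t2; split=> //=; rewrite rxy.
Qed.

(** Domination of configurations only provides some listing of their tokens. Carrying each partner
    along with its permuted element lets the listing be chosen freely. *)
Lemma all2_perm {s1 s2 t1} : perm_eq s2 s1 -> all2 r s1 t1 ->
  exists2 t2, perm_eq t2 t1 & all2 r s2 t2.
Proof.
elim: s2 s1 t1 => [|x s2 IH] s1 t1.
  by rewrite perm_sym => /perm_nilP-> H; exists t1.
move=> eq12; have x_s1 : x \in s1 by rewrite -(perm_mem eq12) mem_head.
case/splitPr: x_s1 eq12 => a b.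
rewrite perm_sym (perm_catCA a [:: x] b) perm_cons perm_sym => eq12.
move=> /all2_cat_inv[ta [[|y tb]] [-> Ha //= /andP[rxy Hb]]].
have [t2 pt2 H2] := IH _ _ eq12 (all2_cat Ha Hb).
exists (y :: t2); last by rewrite /= rxy.
by rewrite perm_sym (perm_catCA ta [:: y] tb) perm_cons perm_sym.
Qed.

End All2.

Lemma seq_mset_cat {K : choiceType} (s t : seq K) :
  seq_mset (s ++ t) = (seq_mset s `+` seq_mset t)%mset.
Proof. by apply/msetP => a; rewrite msetE2 !mset_seqE count_cat. Qed.

(** * The order on tokens and configurations, and totals of inner markings *)

Section Domination.

Context {E : eos_structure}.
Implicit Types (s : seq (token E)) (mu : config E) (x y : token E).

(** Removes the transport hidden in [tagged_as]: once the two places are identified, later proofs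
    compare markings of one and the same type. *)
Lemma token_leP {x y} : token_le x y ->
  exists2 m : marking (obj (typ (tag x))),
    y = Tagged (fun p => marking (obj (typ p))) m & forall q, tagged x q <= m q.
Proof.
case: x y => p m [p' m'] /andP[/= /eqP ep /forallP le_m].
by case: _ / ep => /= in m' le_m *; exists m' => // q;
  have:= le_m q; rewrite tagged_asE.
Qed.

Lemma token_le_Tagged x (m : marking (obj (typ (tag x)))) :
  (forall q, tagged x q <= m q) ->
  token_le x (Tagged (fun p => marking (obj (typ p))) m).
Proof.
by move=> le_m; rewrite /token_le eqxx; apply/forallP => q; rewrite tagged_asE.
Qed.

Lemma token_le_refl x : token_le x x.
Proof. by case: x => p m; apply: token_le_Tagged. Qed.

Lemma token_le_trans : transitive (@token_le E).
Proof.
move=> y x z /token_leP[m -> le_m] /token_leP[m' -> le_m'].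
by apply: token_le_Tagged => q; apply: leq_trans (le_m q) (le_m' q).
Qed.

Lemma token_le_tag {x y} : token_le x y -> tag x = tag y.
Proof. by case/andP => /eqP. Qed.

(** Equality proofs in [objs E] are unique, so the cast inside [inner] is the identity. *)
Lemma inner_Tagged (p : place (sys E)) (m : marking (obj (typ p))) :
  inner (typ p) (Tagged (fun p => marking (obj (typ p))) m) = m.
Proof.
rewrite /inner /=; case: eqP => // e.
by rewrite (eq_irrelevance e (erefl _)).
Qed.

Lemma inner_le {x y k} (q : place (obj k)) :
  token_le x y -> inner k x q <= inner k y q.
Proof.
case: x => p m /token_leP[m' -> /= le_m].
rewrite /inner /=; case: eqP => // e.
by case: _ / e in q *; apply: le_m.
Qed.

Lemma all2_token_le_refl s : all2 (@token_le E) s s.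
Proof. by elim: s => //= x s ->; rewrite token_le_refl. Qed.

Lemma all2_token_le_trans {s1 s2 s3} : all2 (@token_le E) s1 s2 ->
  all2 (@token_le E) s2 s3 -> all2 (@token_le E) s1 s3.
Proof.
elim: s1 s2 s3 => [|x s1 IH] [|y s2] [|z s3] //= /andP[xy H12] /andP[yz H23].
by rewrite (token_le_trans _ _ _ xy yz) (IH _ _ H12 H23).
Qed.

Lemma all2_token_le_tag {s1 s2} : all2 (@token_le E) s1 s2 ->
  [seq tag x | x <- s1] = [seq tag x | x <- s2].
Proof.
elim: s1 s2 => [|x s1 IH] [|y s2] //= /andP[/token_le_tag-> /IH->] //.
Qed.

Lemma config_le_seq {s mu} : config_le (seq_mset s) mu ->
  exists s' nu, mu = (seq_mset s' `+` nu)%mset /\ all2 (@token_le E) s s'.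
Proof.
move=> [t [t' [nu [/eq_seq_msetP eq_st -> le_t]]]].
have [s' /eq_seq_msetP eq_s' le_s] := all2_perm _ eq_st le_t.
by exists s', nu; rewrite eq_s'.
Qed.

Lemma config_le_refl mu : config_le mu mu.
Proof.
exists mu, mu, mset0; split; rewrite ?seq_mset_id ?msetD0 //.
exact: all2_token_le_refl.
Qed.

Lemma config_le_trans mu1 mu2 mu3 :
  config_le mu1 mu2 -> config_le mu2 mu3 -> config_le mu1 mu3.
Proof.
move=> [s1 [s2 [nu [-> -> le12]]]].
(* The surplus is listed too, so that the middle configuration becomes one sequence; whatever
   dominates the surplus is again surplus. *)
rewrite -[X in (_ `+` X)%mset]seq_mset_id -seq_mset_cat.
move=> /config_le_seq[t [nu' [-> /all2_cat_inv[t1 [t2 [-> le2 _]]]]]].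
exists s1, t1, (seq_mset t2 `+` nu')%mset; split=> //.
  by rewrite seq_mset_cat msetDA.
exact: all2_token_le_trans le12 le2.
Qed.

(** The analogue of [Pi2] on sequences, where dominating tokens are matched and induction is
    available. *)
Definition inner_sum s (k : objs E) (q : place (obj k)) : nat :=
  \sum_(x <- s | typ (tag x) == k) inner k x q.

Lemma inner_sum_cons x s (k : objs E) (q : place (obj k)) :
  inner_sum (x :: s) k q =
  (if typ (tag x) == k then inner k x q else 0) + inner_sum s k q.
Proof. by rewrite /inner_sum big_cons; case: ifP. Qed.

Lemma Pi1_seq s p : Pi1 (seq_mset s) p = count_mem p [seq tag x | x <- s].
Proof.
rewrite /Pi1 (perm_big _ (perm_eq_seq_mset s)) /=.
by elim: s => [|x s IH]; rewrite ?big_nil // big_cons IH.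
Qed.

Lemma Pi2_seq s (k : objs E) (q : place (obj k)) :
  Pi2 (seq_mset s) q = inner_sum s k q.
Proof. exact: perm_big (perm_eq_seq_mset s). Qed.

Lemma inner_sum_le {s1 s2} (k : objs E) (q : place (obj k)) :
  all2 (@token_le E) s1 s2 -> inner_sum s1 k q <= inner_sum s2 k q.
Proof.
elim: s1 s2 => [|x s1 IH] [|y s2] //= /andP[xy /IH le_s].
rewrite !inner_sum_cons -(token_le_tag xy) leq_add //.
by case: ifP => // _; apply: inner_le.
Qed.

Lemma inner_sum_neq0 {s} {k : objs E} {q : place (obj k)} :
  inner_sum s k q != 0 -> exists2 p, p \in [seq tag x | x <- s] & typ p = k.
Proof.
elim: s => [|x s IH]; first by rewrite /inner_sum big_nil.
rewrite inner_sum_cons /=; case: (_ =P k) => [xk _|_ /IH[p ps pk]].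
  by exists (tag x); rewrite ?mem_head.
by exists p; rewrite // inE ps orbT.
Qed.

(** The first token of each type takes the whole excess of that type; the hypothesis provides such a
    token wherever there is something to place. *)
Lemma absorb_excess s (ex : forall k : objs E, place (obj k) -> nat) :
  (forall k q, ex k q != 0 ->
     exists2 p, p \in [seq tag x | x <- s] & typ p = k) ->
  exists2 s', all2 (@token_le E) s s' &
    forall k q, inner_sum s' k q = inner_sum s k q + ex k q.
Proof.
elim: s ex => [|x s IH] ex ex_s.
  exists [::] => // k q; rewrite -[LHS]addn0; congr (_ + _).
  by apply/esym/eqP; apply: contraT => /ex_s[].
(* What is left for the tail: the head takes everything of its own type. *)
pose ex' k q := if k == typ (tag x) then 0 else ex k q.
have [|s' le_s sum_s'] := IH ex'.
  move=> k q; rewrite /ex'; case: (k =P _) => // nk /ex_s[p].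
  by rewrite inE => /predU1P[-> pk|ps pk]; [case: nk | exists p].
case: x {ex_s} @ex' sum_s' => p m ex' sum_s'.
pose m' : marking (obj (typ p)) := [ffun q => m q + ex (typ p) q].
exists (Tagged (fun p => marking (obj (typ p))) m' :: s') => [|k q] /=.
  rewrite le_s andbT.
  apply: (token_le_Tagged (existT _ p m)) => q /=.
  by rewrite ffunE leq_addr.
rewrite !inner_sum_cons sum_s' /= /ex'; case: (eqVneq (typ p) k) => [e|_] /=.
  by case: _ / e in q *; rewrite !inner_Tagged ffunE addn0 addnAC.
by rewrite !add0n.
Qed.

End Domination.

(** * Embedding into the conservative closure, and simulation of runs *)

Section ConservativeClosure.

Context {E : eos_structure}.
Implicit Types (s : seq (token E)) (mu : config E) (t : trans (sys E)).

Lemma cons_token_le (x y : token E) :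
  token_le x y -> token_le (cons_token x) (cons_token y).
Proof.
case: x => p m /token_leP[m' -> le_m].
exact: (token_le_Tagged (E := cons_closure E) (cons_token (existT _ p m))).
Qed.

Lemma cons_config_seq s : cons_config (seq_mset s) =
  seq_mset [seq cons_token x | x <- s].
Proof. by apply/eq_seq_msetP/perm_map/perm_eq_seq_mset. Qed.

Lemma cons_configD (mu nu : config E) :
  cons_config (mu `+` nu)%mset = (cons_config mu `+` cons_config nu)%mset.
Proof.
rewrite -[in LHS](seq_mset_id mu) -[in LHS](seq_mset_id nu) -seq_mset_cat.
by rewrite cons_config_seq map_cat seq_mset_cat.
Qed.

Lemma cons_config_le (mu nu : config E) :
  config_le mu nu -> config_le (cons_config mu) (cons_config nu).
Proof.
move=> [s [s' [nu' [-> -> le_s]]]].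
exists [seq cons_token x | x <- s], [seq cons_token x | x <- s'].
exists (cons_config nu'); rewrite cons_configD !cons_config_seq; split=> //.
elim: s s' le_s => [|x s IH] [|y s'] //= /andP[/cons_token_le-> /IH->] //.
Qed.

Lemma inner_sum_cons_tokens s (k : objs E) (q : place (obj k)) :
  inner_sum (E := cons_closure E) [seq cons_token x | x <- s] k q =
  inner_sum s k q.
Proof. by rewrite /inner_sum big_map. Qed.

(** These tokens start empty, which leaves the inner totals unchanged; [absorb_excess] fills them
    afterwards as needed. *)
Definition trash_tokens t : seq (token (cons_closure E)) :=
  [seq Tagged (fun p : place (sys (cons_closure E)) => marking (obj (typ p)))
     ([ffun=> 0] : marking (obj (@typ (cons_closure E) (inr k))))
  | k <- enum (destroy t)].

Lemma inner_sum_trash t (k : objs E) (q : place (obj k)) :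
  inner_sum (trash_tokens t) k q = 0.
Proof.
rewrite /inner_sum big_map big1 // => j /eqP e.
by case: _ / e in q *; rewrite inner_Tagged ffunE.
Qed.

Lemma count_tag_cons_tokens s (p : place (cons_net E)) :
  count_mem p [seq tag (cons_token x) | x <- s] =
  if p is inl p' then count_mem p' [seq tag x | x <- s] else 0.
Proof.
rewrite !count_map; case: p => [p|k].
  by rewrite count_map.
by rewrite (eq_count (a2 := pred0)) ?count_pred0.
Qed.

(** The enumeration of [destroy t] has no repetitions, so each trash place gets exactly the weight 0
    or 1 of its arc in [cons_net]. *)
Lemma count_tag_trash t (p : place (cons_net E)) :
  count_mem p [seq tag x | x <- trash_tokens t] =
  if p is inr k then (k \in destroy t : nat) else 0.
Proof.
rewrite -map_comp count_map; case: p => [p|k].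
  by rewrite (eq_count (a2 := pred0)) ?count_pred0.
rewrite (eq_count (a2 := pred1 k)) //.
by rewrite count_uniq_mem ?enum_uniq // mem_enum.
Qed.

Lemma fires_dominated (e : event E) mu mu' (nu : config (cons_closure E)) :
  fires e mu mu' -> config_le (cons_config mu) nu ->
  exists2 nu', fires (E := cons_closure E) e nu nu' &
               config_le (cons_config mu') nu'.
Proof.
move=> [lam [rho [[sub_lam pre_lam post_rho en_lam eff_rho] ->]]].
pose C (A : config E) := [seq cons_token x | x <- A].
(* Splits [mu] into [lam] and the rest: [l] dominates the consumed tokens, [m] the untouched ones,
   and [nu0] is surplus. *)
rewrite -{1}(msetBDKC sub_lam) cons_configD -seq_mset_cat.
move=> /config_le_seq[s' [nu0 [-> /all2_cat_inv[l [m [-> le_l le_m]]]]]].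
have Pi2E (A : config E) k (q : place (obj k)) : Pi2 A q = inner_sum A k q.
  by [].
have Pi1E (A : config E) p : Pi1 A p = count_mem p [seq tag x | x <- A].
  by rewrite -Pi1_seq seq_mset_id.
(* The truncated subtraction is exact, by [le_ex] below. *)
pose ex k (q : place (obj k)) :=
  inner_sum (E := cons_closure E) l k q - Pi2 lam q.
have le_ex k (q : place (obj k)) :
    Pi2 lam q <= inner_sum (E := cons_closure E) l k q.
  by rewrite Pi2E -inner_sum_cons_tokens; apply: inner_sum_le le_l.
have [|r le_r sum_r] :=
  absorb_excess (E := cons_closure E) (C rho ++ trash_tokens e.1) ex.
  move=> k q ex_kq.
  (* Excess of type [k] requires a token of type [k] in [l], which has the same places as [lam]; so
     the event consumes from a place of type [k]. *)
  have /inner_sum_neq0[p] : inner_sum (E := cons_closure E) l k q != 0.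
    by apply: contraNneq ex_kq; rewrite /ex => ->.
  rewrite -(all2_token_le_tag le_l) -map_comp => /mapP[x x_lam ->] /= pk.
  have pre_x : pre_arc (tag x) e.1 != 0.
    by rewrite -pre_lam Pi1E -lt0n -has_count has_pred1 map_f.
  (* If [k] is destroyed, its trash token is available. Otherwise, as type [k] is consumed, the
     event has an output place of type [k], and [rho] has a token there. *)
  case: (boolP (k \in destroy e.1)) => [kd|].
    exists (inr k) => //; rewrite -has_pred1 has_count map_cat count_cat.
    by rewrite count_tag_trash kd addn1.
  rewrite inE negb_and negb_exists => /orP[/forallP/(_ (tag x))|].
    by rewrite pk eqxx pre_x.
  case/forallPn => p'; rewrite negb_imply => /andP[/eqP p'k post_p'].
  exists (inl p') => //; rewrite -has_pred1 has_count map_cat count_cat.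
  by rewrite -map_comp count_tag_cons_tokens -Pi1E post_rho ltn_addr ?lt0n.
(* The part [r2] over the trash tokens has no counterpart in [rho] and counts as surplus. *)
have [r1 [r2 [def_r le_r1 le_r2]]] := all2_cat_inv _ le_r.
exists (seq_mset m `+` nu0 `+` seq_mset r)%mset; last first.
  exists (C (mu `\` lam)%mset ++ C rho), (m ++ r1), (nu0 `+` seq_mset r2)%mset.
  split; first by rewrite cons_configD seq_mset_cat.
    rewrite def_r !seq_mset_cat -!msetDA; congr (_ `+` _)%mset.
    by rewrite msetDCA.
  exact: all2_cat.
exists (seq_mset l), (seq_mset r); split; last first.
  by congr (_ `+` _)%mset; rewrite seq_mset_cat -msetDA msetDKB.
split.
- by rewrite seq_mset_cat -msetDA -subset_msetBLR msetBxx msub0set.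
- move=> p; rewrite Pi1_seq -(all2_token_le_tag le_l) -map_comp.
  by rewrite count_tag_cons_tokens; case: p => //= p; rewrite -Pi1E.
- move=> p; rewrite Pi1_seq -(all2_token_le_tag le_r) map_cat count_cat.
  rewrite -map_comp count_tag_cons_tokens count_tag_trash; case: p => //= p.
  by rewrite -Pi1E addn0.
- by move=> k q; rewrite Pi2_seq; apply: leq_trans (en_lam k q) (le_ex k q).
(* The excess cancels the total of [lam] against that of [l]. No truncation interferes, because what
   the event requires is at most the total of [lam], itself at most that of [l]. *)
- move=> k q; rewrite !Pi2_seq sum_r /inner_sum big_cat /= -!/(inner_sum _ k q).
  rewrite inner_sum_trash addn0 inner_sum_cons_tokens -Pi2E eff_rho /ex.
  have := en_lam k q; have := le_ex k q.
  move: (Pi2 _ _) (inner_sum _ _ _) => a b.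
  by move=> le_ab le_a; rewrite addnAC addnBAC // subnKC.
Qed.

(** A lossy step needs no answer: the same [nu] still dominates the smaller configuration. Firing
    steps are matched one for one. *)
Lemma lossy_run_dominated (mu mu' : config E) (nu : config (cons_closure E)) :
  clos_refl_trans_1n (config E) (@lossy_run_step E) mu mu' ->
  config_le (cons_config mu) nu ->
  exists2 nu', clos_refl_trans_1n _ (@fire_step (cons_closure E)) nu nu' &
               config_le (cons_config mu') nu'.
Proof.
move=> run; elim: run nu => {mu mu'} [mu|mu mu1 mu2 step _ IH] nu le_nu.
  by exists nu => //; apply: rt1n_refl.
case: step => [[e eE fire_e]|loss].
  have [nu1 fire_nu /IH[nu2 run2 le2]] := fires_dominated _ _ _ _ fire_e le_nu.
  by exists nu2 => //; apply: rt1n_trans run2; exists e.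
by apply: IH; apply: config_le_trans le_nu; apply: cons_config_le.
Qed.

End ConservativeClosure.

Theorem theorem4 (E : eos) (iota tau : config E) :
  standing_assumptions E ->
  lossy_coverable iota tau ->
  coverable (cons_config iota) (cons_config tau).
Proof.
move=> _ [mu run le_tau].
have [nu run_nu le_nu] := lossy_run_dominated _ _ _ run (config_le_refl _).
by exists nu => //; apply: config_le_trans le_nu; apply: cons_config_le.
Qed.
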